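(* Let $\alpha\in L^1([0,\infty))$ with $\alpha\ge0$, $\sigma\in L^1_{\rm loc}([0,\infty))$ with $\sigma\ge0$, and let $\rho_\pm>0$, $u_\pm\in\mathbb{R}$ with $u_-<u_+$. Put $A(t)=\int_0^t\alpha(s)e^{-\int_0^s\sigma(r)dr}ds$. Then the Riemann problem $$\rho_t+\alpha(t)(\rho u)_x=0,\qquad(\rho u)_t+\alpha(t)(\rho u^2)_x=-\sigma(t)\rho u,$$ $$(\rho(x,0),u(x,0))=(\rho_-,u_-)\ \text{ if }x<0,\qquad(\rho_+,u_+)\ \text{ if }x>0,$$ has the solution $$(\rho(x,t),u(x,t))=\begin{cases}\left(\rho_-,\,u_-e^{-\int_0^t\sigma(r)dr}\right),& x<u_-A(t),\\ \left(0,\,\frac{x}{A(t)}e^{-\int_0^t\sigma(r)dr}\right),& u_-A(t)\le x\le u_+A(t),\\ \left(\rho_+,\,u_+e^{-\int_0^t\sigma(r)dr}\right),& x>u_+A(t).\end{cases}$$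
   Context: The solution is understood in the sense of distributions. At times with $A(t)=0$ the middle region reduces to the single point $x=0$, and the value assigned there is irrelevant (null set). *)

(* Defs.v *)
From mathcomp Require Import all_boot all_order all_algebra.
From mathcomp Require Import all_classical all_reals all_analysis.

Set Implicit Arguments.
Unset Strict Implicit.
Unset Printing Implicit Defensive.

Import Order.TTheory GRing.Theory Num.Theory.
Import numFieldNormedType.Exports.

Local Open Scope classical_set_scope.
Local Open Scope ring_scope.

Section FunctionClasses.
Context {R : realType}.
Implicit Types (f : R -> R) (w : R -> R -> R) (phi : R * R -> R).

Definition L1_half_line f :=
  (@lebesgue_measure R).-integrable `[0, +oo[ (EFin \o f).

Definition L1loc_half_line f :=
  forall T : R, (@lebesgue_measure R).-integrable `[0, T] (EFin \o f).

Definition nonneg_ae f :=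
  {ae @lebesgue_measure R, forall t : R, 0 <= t -> 0 <= f t}.

(* Points of the plane are pairs (x, t), space first. *)
Definition lebesgue2 := (@lebesgue_measure R \x @lebesgue_measure R)%E.

Definition half_plane : set (measurableTypeR R * measurableTypeR R) :=
  setT `*` `[0, +oo[.

(* Local integrability up to and including the boundary t = 0. *)
Definition L1loc_half_plane w :=
  forall r : R, lebesgue2.-integrable (`[- r, r] `*` `[0, r])
    (fun z => (w z.1 z.2)%:E).

Definition iter_derive (vs : seq (R * R)) phi : R * R -> R :=
  foldr (fun v psi => 'D_v psi) phi vs.

(* Differentiability at every order makes each iterated derivative continuous,
   so this is the class C^oo(R x R). *)
Definition smooth phi :=
  forall (vs : seq (R * R)) (z : R * R), differentiable (iter_derive vs phi) z.

(* The support may meet the line t = 0: after restriction to t >= 0 these are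
   the elements of C_c^oo(R x [0, +oo[). *)
Definition test_function phi :=
  smooth phi /\ compact (closure [set z : R * R | phi z != 0]).

End FunctionClasses.

Section DistributionalSolutions.
Context {R : realType}.

(* w_t + f_x = g on R x ]0, +oo[ with w(., 0) = w0, in the sense of
   distributions: the equation is tested against functions that need not
   vanish at t = 0, so that integrating by parts in t produces the initial
   data.  Test functions supported in t > 0 give the equation in the space of
   distributions on the open half-plane. *)
Definition weak_balance_law (w f g : R -> R -> R) (w0 : R -> R) :=
  [/\ L1loc_half_plane w, L1loc_half_plane f, L1loc_half_plane g &
    forall phi : R * R -> R, test_function phi ->
      \int[lebesgue2]_(z in half_plane)
         (w z.1 z.2 * 'D_(0, 1) phi z + f z.1 z.2 * 'D_(1, 0) phi z
          + g z.1 z.2 * phi z)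
      + \int[@lebesgue_measure R]_(x in setT) (w0 x * phi (x, 0)) = 0].

(* The value chosen at x = 0 only enters under an integral. *)
Definition riemann_data (l r x : R) : R := if x < 0 then l else r.

(* Since alpha depends on t only, the products alpha (rho u)_x and
   alpha (rho u^2)_x are read as (alpha rho u)_x and (alpha rho u^2)_x. *)
Definition riemann_solution (alpha sigma : R -> R) (rhoL uL rhoR uR : R)
    (rho u : R -> R -> R) :=
  [/\ measurable_fun half_plane (fun z => u z.1 z.2),
      weak_balance_law rho
        (fun x t => alpha t * (rho x t * u x t))
        (fun _ _ => 0)
        (riemann_data rhoL rhoR),
      weak_balance_law (fun x t => rho x t * u x t)
        (fun x t => alpha t * (rho x t * u x t ^+ 2))
        (fun x t => - (sigma t * (rho x t * u x t)))
        (fun x => riemann_data rhoL rhoR x * riemann_data uL uR x),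
      (forall x, x < 0 -> rho x 0 = rhoL /\ u x 0 = uL) &
      (forall x, 0 < x -> rho x 0 = rhoR /\ u x 0 = uR)].

End DistributionalSolutions.

Section VacuumSolution.
Context {R : realType}.
Variables (alpha sigma : R -> R) (rhoL uL rhoR uR : R).

Definition damping (t : R) : R :=
  expR (- \int[@lebesgue_measure R]_(r in `[0, t]) sigma r).

Definition amplitude (t : R) : R :=
  \int[@lebesgue_measure R]_(s in `[0, t]) (alpha s * damping s).

Definition vacuum_density (x t : R) : R :=
  if x < uL * amplitude t then rhoL
  else if x <= uR * amplitude t then 0
  else rhoR.

(* When amplitude t = 0 the middle branch is reached only at x = 0, where
   x / 0 = 0. *)
Definition vacuum_velocity (x t : R) : R :=
  if x < uL * amplitude t then uL * damping t
  else if x <= uR * amplitude t then x / amplitude t * damping t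
  else uR * damping t.

End VacuumSolution.

(* Main.v *)
From HB Require Import structures.
Require Import Defs.
From mathcomp Require Import all_boot all_order all_algebra.
From mathcomp Require Import all_classical all_reals all_analysis.
From mathcomp Require Import measurable_realfun.
From mathcomp Require Import ring lra.

Set Implicit Arguments.
Unset Strict Implicit.
Unset Printing Implicit Defensive.

Import Order.TTheory GRing.Theory Num.Theory.
Import numFieldNormedType.Exports.

Local Open Scope classical_set_scope.
Local Open Scope ring_scope.

(** Each of the two non-vacuum regions is moved rigidly: the left one is
    [x - X t < 0] and the right one [x - X t > 0], where [X t] is [uL * A t],
    respectively [uR * A t].  In the coordinate [y = x - X t] such a region is
    a fixed set [S].  Suppose that [X' = a] and [m' = n] almost everywhere,
    with [X 0 = 0].  For a test function [phi], the function
    [t |-> m t * phi (y + X t, t)] has derivative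
    [m * phi_t + m * a * phi_x + n * phi] along the curve, and it vanishes for
    large [t], so the integral of this derivative over [t >= 0] is
    [- m 0 * phi (y, 0)].  Integrating over [y] in [S], exchanging the
    integrals, and returning to [x] by a translation for each fixed [t] gives
    the weak form of a balance law for the density [m], with flux [m * a],
    source [n] and initial datum [m 0], all restricted to the moving region:
    this is [transport_identity].

    Both equations are of this form in both regions.  Let [D] be the damping
    factor, so that [D' = - sigma * D] and [A' = alpha * D]; then
    [a = uL * alpha * D] on the left.  Conservation of mass is the case
    [m = rhoL], [n = 0], and the momentum equation is the case
    [m = rhoL * uL * D], [n = - sigma * m].  The vacuum between the two regions
    carries neither mass nor momentum, and so adds nothing to the integrals
    ([vacuum_regions], [weak_balance_law_two_regions]).

    The coefficients are merely integrable, so [X] and [m] are only absolutely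
    continuous and the differentiation along the curve is understood through
    integrals.  The required [chain_rule] is obtained from a local estimate:
    near each time the increment of the composite differs from the integral of
    the expected derivative by at most a small multiple of the variation of
    the curve, and such a bound on increments spreads from short intervals to
    long ones ([le_increment_local]).  The change of variable is the invariance
    of the Lebesgue measure of the plane under the shears
    [(y, t) |-> (y + X t, t)] ([lebesgue2_shear]). *)

(** * Antiderivatives of locally integrable functions *)

Section Antiderivatives.
Context {R : realType}.
Notation mu := (@lebesgue_measure R).
Implicit Types (f F : R -> R).

(** On bounded intervals these are the absolutely continuous functions, each
    given with one choice of its almost everywhere derivative; nothing is said
    about negative arguments. *)
Definition antiderivative f F :=
  L1loc_half_line f /\
  forall t, 0 <= t -> F t = F 0 + \int[mu]_(s in `[0, t]) f s.

Lemma L1loc_subset f (A : set R) (T : R) : L1loc_half_line f -> measurable A ->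
  A `<=` `[0, T] -> mu.-integrable A (EFin \o f).
Proof. by move=> fl mA AT; apply: integrableS (fl T). Qed.

Lemma itv_sub_loc (a b : R) : 0 <= a -> `]a, b] `<=` `[0, b].
Proof. by move=> a0; apply: subset_itvr; rewrite bnd_simp. Qed.

Lemma antiderivativeB f F a b : antiderivative f F -> 0 <= a -> a <= b ->
  F b - F a = \int[mu]_(s in `]a, b]) f s.
Proof.
move=> [fl fF] a0 ab; have b0 : 0 <= b := le_trans a0 ab.
by rewrite (fF b)// (fF a)// opprD addrACA subrr add0r Rintegral_itvB// bnd_simp.
Qed.

Lemma L1loc_norm f : L1loc_half_line f -> L1loc_half_line (fun t => `|f t|).
Proof. by move=> fl T; exact: integrable_norm. Qed.

Lemma L1locD f g : L1loc_half_line f -> L1loc_half_line g ->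
  L1loc_half_line (fun t => f t + g t).
Proof. by move=> fl gl T; apply: integrableD (fl T) (gl T). Qed.

Lemma L1locZ (k : R) f : L1loc_half_line f -> L1loc_half_line (fun t => k * f t).
Proof. by move=> fl T; apply: integrableZl (fl T). Qed.

Lemma antiderivative_integral f : L1loc_half_line f ->
  antiderivative f (fun t => \int[mu]_(s in `[0, t]) f s).
Proof.
by move=> fl; split=> // t t0; rewrite set_itv1 Rintegral_set1 add0r.
Qed.

Lemma antiderivative_norm f F a b : antiderivative f F -> 0 <= a -> a <= b ->
  `|F b - F a| <= \int[mu]_(s in `]a, b]) `|f s|.
Proof.
move=> fF a0 ab; rewrite (antiderivativeB fF)//.
apply: le_normr_Rintegral => //; case: fF => fl _.
exact: (L1loc_subset fl _ (itv_sub_loc a0)).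
Qed.

(** Clamping the argument at 0 gives a function that is continuous on the whole
    line, although [F] is arbitrary at negative arguments. *)
Lemma antiderivative_continuous f F : antiderivative f F ->
  continuous (fun t : R => F (Num.max 0 t)).
Proof.
move=> fF t; have [fl _] := fF.
pose T := Num.max 0 t + 1; pose g := f \_ `[0, T].
have gint : mu.-integrable setT (EFin \o g).
  by rewrite -restrict_EFin; apply/integrable_restrict => //=; rewrite setTI.
apply/cvgrPdist_lt => e e0.
have [d [d0 fd]] := integral_normr_continuous gint e0.
have near a b : 0 <= a -> a <= b -> b <= T -> b - a < d -> `|F b - F a| < e.
  move=> a0 ab bT abd; apply: le_lt_trans (antiderivative_norm fF a0 ab) _.
  rewrite (@eq_Rintegral _ _ _ mu _ (fun s => `|g s|)).
    have mud : (mu `]a, b] < d%:E)%E.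
      rewrite lebesgue_measure_itv/=.
      by case: ifPn => // _; rewrite -EFinB lte_fin.
    exact: fd mud.
  move=> s; rewrite inE/= in_itv/= => /andP[sa sb]; rewrite /g patchE ifT//.
  by rewrite inE/= in_itv/= (ltW (le_lt_trans a0 sa)) (le_trans sb bT).
have maxl (a b : R) : Num.max 0 a - Num.max 0 b <= `|a - b|.
  by rewrite /Num.max; case: ltP => ?; case: ltP => ?; have := ler_norm (a - b);
    have := normr_ge0 (a - b); lra.
near=> s.
have sd : `|s - t| < d by near: s; apply: cvgr_distC_lt.
have s1 : `|s - t| < 1 by near: s; apply: cvgr_distC_lt.
have := maxl s t; have := maxl t s; rewrite (distrC t s) => h1 h2.
have m0 (a : R) : 0 <= Num.max 0 a by rewrite le_max lexx.
have [st|st] := leP (Num.max 0 s) (Num.max 0 t).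
  by apply: near => //; rewrite /T; lra.
by rewrite distrC; apply: near => //; rewrite /T; lra.
Unshelve. all: by end_near. Qed.

End Antiderivatives.

(** * The chain rule along absolutely continuous curves *)

Section ChainRule.
Context {R : realType}.
Notation mu := (@lebesgue_measure R).
Implicit Types (f F x X y Y N H : R -> R) (Phi P Q : R -> R -> R).

(** A bound on increments that holds around each point holds from [0] to [T]:
    the supremum of the times up to which it holds is itself such a time, and
    cannot be smaller than [T] because the local bound carries it further. *)
Lemma le_increment_local H N (T : R) : 0 <= T ->
  (forall t, 0 <= t -> t <= T -> exists2 d, 0 < d & forall a b,
     0 <= a -> t - d < a -> a <= t -> t <= b -> b < t + d -> b <= T ->
     `|H b - H a| <= N b - N a) ->
  `|H T - H 0| <= N T - N 0.
Proof.
move=> T0 loc.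
pose S := [set t | [/\ 0 <= t, t <= T & `|H t - H 0| <= N t - N 0]].
have S0 : S 0 by split => //; rewrite !subrr normr0.
have supS : has_sup S by split; [exists 0|exists T => t []].
pose c := sup S.
have c0 : 0 <= c by apply: ub_le_sup => //; exact: supS.2.
have cT : c <= T by apply: ge_sup => [|t []//]; exists 0.
have [d d0 dloc] := loc c c0 cT.
have [s [s0 sT Hs] cds] := sup_adherent d0 supS.
have sc : s <= c by apply: ub_le_sup; [exact: supS.2|].
(* The bound reaches every point of [T] slightly beyond the supremum [c]. *)
have step b : c <= b -> b < c + d -> b <= T -> S b.
  move=> cb bcd bT; split => //; first exact: le_trans cb.
  have := dloc s b s0 cds sc cb bcd bT => Hb.
  have := ler_normD (H b - H s) (H s - H 0); rewrite addrA subrK.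
  lra.
have [|cltT] := leP T c.
  move=> Tc; have -> : T = c by apply/eqP; rewrite eq_le Tc cT.
  by case: (step c); rewrite ?ltrDl.
have : S (Num.min T (c + d / 2)).
  apply: step; rewrite ?le_min ?gt_min ?ge_min ?lexx ?(ltW cltT) ?lerDl ?ltrD2l//=.
    by rewrite divr_ge0// ltW.
  by apply/orP; right; lra.
move=> /(ub_le_sup supS.2); rewrite -/c leNgt lt_min cltT ltrDl/=.
by rewrite divr_gt0.
Qed.

(** [P] and [Q] are the partial derivatives of the curried function [Phi]. *)
Definition C1_with Phi P Q :=
  [/\ forall x y : R, is_derive x 1 (Phi ^~ y) (P x y),
      forall x y : R, is_derive y 1 (Phi x) (Q x y),
      continuous (fun z : R * R => P z.1 z.2) &
      continuous (fun z : R * R => Q z.1 z.2)].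

(** The mean value theorem, with no order imposed on the end points. *)
Lemma MVT_slope (g dg : R -> R) (k e a b : R) :
  (forall t : R, is_derive t 1 g (dg t)) ->
  (forall t, (a <= t <= b) \/ (b <= t <= a) -> `|dg t - k| <= e) ->
  `|g b - g a - k * (b - a)| <= e * `|b - a|.
Proof.
move=> gd; wlog ab : a b / a <= b => [wl|].
  have [ab|/ltW ba] := leP a b; first exact: wl.
  move=> h; have := wl b a ba (fun t ht => h t (proj1 (or_comm _ _) ht)).
  rewrite (distrC a b); suff -> : g a - g b - k * (a - b) = - (g b - g a - k * (b - a)).
    by rewrite normrN.
  by ring.
move=> h; have gc : {within `[a, b], continuous g}.
  by apply: derivable_within_continuous => t _; exact: ex_derive.
have [c + ->] := MVT_segment ab (fun t _ => gd t) gc.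
rewrite in_itv/= => /andP[ac cb].
rewrite -mulrBl normrM ler_wpM2r//; apply: h.
by rewrite ac cb; left.
Qed.

Lemma continuous2_near P (p1 p2 e : R) : continuous (fun z : R * R => P z.1 z.2) ->
  0 < e -> exists2 d, 0 < d & forall q1 q2, `|q1 - p1| < d -> `|q2 - p2| < d ->
    `|P q1 q2 - P p1 p2| <= e.
Proof.
move=> /(_ (p1, p2)) /cvgrPdist_le Pc e0.
have /nbhs_ballP[d /= d0 dP] := Pc _ e0.
exists d => // q1 q2 h1 h2; rewrite distrC; apply: (dP (q1, q2)).
by split; rewrite /ball/= distrC.
Qed.

(** Continuity of the partial derivatives makes [Phi] strictly differentiable:
    going from [(r1, r2)] to [(q1, q2)] along two sides of a rectangle, the mean
    value theorem applies on each side. *)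
Lemma C1_strict Phi P Q (p1 p2 e : R) : C1_with Phi P Q -> 0 < e ->
  exists2 d, 0 < d & forall q1 q2 r1 r2,
    `|q1 - p1| < d -> `|q2 - p2| < d -> `|r1 - p1| < d -> `|r2 - p2| < d ->
    `|Phi q1 q2 - Phi r1 r2 - P p1 p2 * (q1 - r1) - Q p1 p2 * (q2 - r2)|
      <= e * (`|q1 - r1| + `|q2 - r2|).
Proof.
move=> [dP dQ cP cQ] e0.
have [d1 d10 hP] := continuous2_near p1 p2 cP e0.
have [d2 d20 hQ] := continuous2_near p1 p2 cQ e0.
exists (Num.min d1 d2) => [|q1 q2 r1 r2]; first by rewrite lt_min d10.
rewrite !lt_min => /andP[q11 q12] /andP[q21 q22] /andP[r11 r12] /andP[r21 r22].
have btw (a b t p d : R) : `|a - p| < d -> `|b - p| < d ->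
    (a <= t <= b) \/ (b <= t <= a) -> `|t - p| < d.
  rewrite !ltr_norml => /andP[? ?] /andP[? ?].
  by case=> /andP[? ?]; apply/andP; split; lra.
have h1 := @MVT_slope (Phi ^~ q2) (P ^~ q2) (P p1 p2) e r1 q1 (dP^~ q2)
  (fun t ht => hP t q2 (btw _ _ _ _ _ r11 q11 ht) q21).
have h2 := @MVT_slope (Phi r1) (Q r1) (Q p1 p2) e r2 q2 (dQ r1)
  (fun t ht => hQ r1 t r12 (btw _ _ _ _ _ r22 q22 ht)).
have -> : Phi q1 q2 - Phi r1 r2 - P p1 p2 * (q1 - r1) - Q p1 p2 * (q2 - r2) =
    (Phi q1 q2 - Phi r1 q2 - P p1 p2 * (q1 - r1)) +
    (Phi r1 q2 - Phi r1 r2 - Q p1 p2 * (q2 - r2)) by ring.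
by rewrite (mulrDr e) (le_trans (ler_normD _ _))// lerD.
Qed.

Lemma L1locM_continuous (g z : R -> R) : continuous g ->
  L1loc_half_line z -> L1loc_half_line (fun t => g t * z t).
Proof.
move=> gc zl T.
have bg : [bounded g t | t in `[0, T]%classic].
  have [M [_ gM]] := compact_bounded (continuous_compact
    (continuous_subspaceT gc) (@segment_compact R 0 T)).
  exists M; split; first exact: num_real.
  by move=> r Mr t tT /=; apply: gM => //; exists t.
have mg : measurable_fun `[0, T] g.
  by apply: measurable_funTS; exact: continuous_measurable_fun.
suff : mu.-integrable `[0, T] ((EFin \o g) \* (EFin \o z))%E by [].
by apply: integrableMr => //; exact: zl.
Qed.

(** The difference [H] between the composite and the integral of the expected
    derivative [k] has increments bounded, near each time, by an arbitrarily
    small multiple of the integral of [n = |x| + |y|]: strict differentiability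
    controls the composite, continuity of the partial derivatives controls the
    integral.  Hence [H] is constant. *)
Lemma chain_rule Phi P Q x X y Y : C1_with Phi P Q ->
  antiderivative x X -> antiderivative y Y ->
  antiderivative (fun t => P (X t) (Y t) * x t + Q (X t) (Y t) * y t)
                 (fun t => Phi (X t) (Y t)).
Proof.
move=> C1 xX yY; have [_ _ cP cQ] := C1; have [xl _] := xX; have [yl _] := yY.
have cXY (S : R -> R -> R) : continuous (fun z : R * R => S z.1 z.2) ->
    continuous (fun t : R => S (X (Num.max 0 t)) (Y (Num.max 0 t))).
  move=> cS t; apply: (@continuous_comp _ _ _
    (fun t : R => (X (Num.max 0 t), Y (Num.max 0 t))) (fun z : R * R => S z.1 z.2)).
    exact: (cvg_pair (antiderivative_continuous xX (x:=t))
                     (antiderivative_continuous yY (x:=t))).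
  exact: cS.
have L1S (S : R -> R -> R) z : continuous (fun z : R * R => S z.1 z.2) ->
    L1loc_half_line z -> L1loc_half_line (fun t => S (X t) (Y t) * z t).
  move=> cS zl T.
  have := L1locM_continuous (cXY S cS) zl T.
  apply: eq_integrable => // t; rewrite inE/= in_itv/= => /andP[t0 _].
  by rewrite /= (max_idPr t0).
have kl := L1locD (L1S _ _ cP xl) (L1S _ _ cQ yl).
split=> // T T0.
set k := (fun t => _) in kl *; pose K t := \int[mu]_(s in `[0, t]) k s.
have kK : antiderivative k K.
  exact: antiderivative_integral kl.
have nl := L1locD (L1loc_norm xl) (L1loc_norm yl).
set n := (fun t => _) in nl; pose N t := \int[mu]_(s in `[0, t]) n s.
have nN : antiderivative n N.
  exact: antiderivative_integral nl.
have K0 : K 0 = 0 by rewrite /K set_itv1 Rintegral_set1.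
have N0 : N 0 = 0 by rewrite /N set_itv1 Rintegral_set1.
have NT : 0 <= N T by apply: Rintegral_ge0 => s _; rewrite addr_ge0.
pose H t := Phi (X t) (Y t) - K t.
(* The error [e * n] occurs twice: in the Taylor bound and under the integral. *)
suff : forall e, 0 < e -> `|H T - H 0| <= 2 * e * N T.
  move=> small; have : `|H T - H 0| <= 0.
    apply/ler_addgt0Pr => e e0; rewrite add0r.
    have M0 : 0 < 2 * (N T + 1) by lra.
    have := small (e / (2 * (N T + 1))) (divr_gt0 e0 M0).
    move/le_trans; apply; rewrite -mulrA mulrCA mulrAC -[leRHS]mulr1 -mulrA.
    rewrite ler_wpM2l ?(ltW e0)//.
    by rewrite ler_pdivrMr// mul1r; lra.
  rewrite normr_le0 subr_eq0 /H K0 subr0 => /eqP; rewrite /K; lra.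
move=> e e0.
have := @le_increment_local H (fun t => 2 * e * N t) T T0; rewrite N0 mulr0 subr0; apply.
move=> t t0 tT.
have [d1 d10 h1] := C1_strict (X t) (Y t) C1 e0.
have [d2 d20 h2] := continuous2_near (X t) (Y t) cP e0.
have [d3 d30 h3] := continuous2_near (X t) (Y t) cQ e0.
pose d := Num.min d1 (Num.min d2 d3).
have d0 : 0 < d by rewrite !lt_min d10 d20.
have near f F : antiderivative f F -> exists2 r, 0 < r & forall s, 0 <= s -> `|s - t| < r ->
    `|F s - F t| < d.
  move=> /antiderivative_continuous/(_ t)/cvgrPdist_lt/(_ _ d0)/nbhs_ballP[r /= r0 hr].
  exists r => // s s0 st; have := hr s; rewrite /ball/= distrC => /(_ st).
  by rewrite (max_idPr t0) (max_idPr s0) distrC.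
have [r1 r10 hX] := near _ _ xX; have [r2 r20 hY] := near _ _ yY.
exists (Num.min r1 r2) => [|a b a0 ta at_ tb bt bT]; first by rewrite lt_min r10.
have b0 : 0 <= b by rewrite (le_trans t0).
have ab : a <= b by exact: le_trans tb.
have inr s : a <= s -> s <= b -> `|s - t| < Num.min r1 r2.
  by move=> as_ sb; rewrite ltr_norml; apply/andP; split; lra.
have nearXY s : a <= s -> s <= b -> `|X s - X t| < d /\ `|Y s - Y t| < d.
  move=> as_ sb; have := inr s as_ sb; rewrite lt_min => /andP[? ?].
  by split; [apply: hX|apply: hY] => //; exact: le_trans as_.
have near1 s : a <= s -> s <= b -> `|X s - X t| < d1 /\ `|Y s - Y t| < d1.
  move=> as_ sb; have [] := nearXY s as_ sb.
  by rewrite !lt_min => /and3P[? _ _] /and3P[? _ _].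
have [Xa Ya] := near1 a (lexx a) ab; have [Xb Yb] := near1 b ab (lexx b).
have taylor := h1 _ _ _ _ Xb Yb Xa Ya.
have intab f : L1loc_half_line f -> mu.-integrable `]a, b] (EFin \o f).
  by move=> fl; exact: L1loc_subset fl _ (itv_sub_loc a0).
have dN : N b - N a = \int[mu]_(s in `]a, b]) `|x s| + \int[mu]_(s in `]a, b]) `|y s|.
  by rewrite (antiderivativeB nN a0 ab) RintegralD//; apply: intab; exact: L1loc_norm.
have dX := antiderivative_norm xX a0 ab; have dY := antiderivative_norm yY a0 ab.
(* [r] is the error made by freezing the partial derivatives at time [t]. *)
pose r s := (P (X s) (Y s) - P (X t) (Y t)) * x s
            + (Q (X s) (Y s) - Q (X t) (Y t)) * y s.
have px := intab _ (L1locZ (P (X t) (Y t)) xl).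
have qy := intab _ (L1locZ (Q (X t) (Y t)) yl).
have rl : mu.-integrable `]a, b] (EFin \o r).
  have := intab _ (L1locD kl (L1locD (L1locZ (- P (X t) (Y t)) xl)
                                     (L1locZ (- Q (X t) (Y t)) yl))).
  apply: eq_integrable => // s _ /=; congr EFin; rewrite /r /k; ring.
have dK : K b - K a = P (X t) (Y t) * (X b - X a) + Q (X t) (Y t) * (Y b - Y a)
    + \int[mu]_(s in `]a, b]) r s.
  rewrite (antiderivativeB kK a0 ab) (antiderivativeB xX a0 ab) (antiderivativeB yY a0 ab).
  rewrite -!RintegralZl//; [|exact: intab|exact: intab].
  rewrite -RintegralD// -RintegralD//; last exact: integrableD px qy.
  by apply: eq_Rintegral => s _; rewrite /r /k; ring.
have rN : `|\int[mu]_(s in `]a, b]) r s| <= e * (N b - N a).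
  apply: le_trans (le_normr_Rintegral _ rl) _ => //.
  rewrite (antiderivativeB nN a0 ab) -RintegralZl//; last exact: intab.
  apply: le_Rintegral => //; [exact: integrable_norm|exact: intab (L1locZ e nl)|].
  move=> s /=; rewrite in_itv/= => /andP[sa sb].
  have [Xs Ys] := nearXY s (ltW sa) sb.
  move: Xs Ys; rewrite !lt_min => /and3P[_ X2 X3] /and3P[_ Y2 Y3].
  rewrite /r /n mulrDr; apply: le_trans (ler_normD _ _) _; rewrite !normrM.
  by apply: lerD; apply: ler_wpM2r => //; [exact: h2|exact: h3].
have -> : H b - H a = (Phi (X b) (Y b) - Phi (X a) (Y a) - P (X t) (Y t) * (X b - X a) -
    Q (X t) (Y t) * (Y b - Y a)) - \int[mu]_(s in `]a, b]) r s.
  rewrite /H; lra.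
apply: le_trans (ler_normB _ _) _.
have eN : e * (`|X b - X a| + `|Y b - Y a|) <= e * (N b - N a).
  by rewrite ler_wpM2l ?(ltW e0)// dN lerD.
have -> : 2 * e * N b - 2 * e * N a = e * (N b - N a) + e * (N b - N a) by ring.
by apply: lerD => //; exact: le_trans eN.
Qed.

End ChainRule.

(** * Measurability in the plane and invariance under shears *)

Section PlaneMeasure.
Context {R : realType}.
Notation mu := (@lebesgue_measure R).
Notation mu2 := (mu \x mu)%E.
Notation line := (measurableTypeR R).
Notation plane := (measurableTypeR R * measurableTypeR R)%type.

(** An open set is the union of the countably many boxes with rational corners
    that it contains. *)
Lemma open_measurable_plane (U : set (R * R)) : open U -> measurable (U : set plane).
Proof.
move=> oU.
pose box (i : (rat * rat) * (rat * rat)) : set plane :=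
  `]ratr i.1.1, ratr i.1.2[ `*` `]ratr i.2.1, ratr i.2.2[.
pose F i : set plane := if `[< box i `<=` U >] then box i else set0.
have -> : (U : set plane) = \bigcup_i F i.
  apply/seteqP; split=> [z Uz|z [i _]]; last by rewrite /F; case: asboolP => // + bz; exact.
  have /nbhs_ballP[e /= e0 eU] : nbhs z U by exact: open_nbhs_nbhs.
  have rat_near (t : R) : exists p : rat * rat,
      ratr p.1 < t < ratr p.2 /\ forall s, ratr p.1 < s < ratr p.2 -> ball t e s.
    have [p] : exists q : rat, ratr q \in `]t - e, t[ by apply: rat_in_itvoo; lra.
    have [q] : exists q : rat, ratr q \in `]t, t + e[ by apply: rat_in_itvoo; lra.
    rewrite !in_itv/= => /andP[tq qe] /andP[ep pt]; exists (p, q).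
    split=> [|s /andP[/= ps sq]]; first by rewrite /= pt.
    by rewrite /ball/= ltr_norml; apply/andP; split; lra.
  have [p1 [zp1 p1e]] := rat_near z.1; have [p2 [zp2 p2e]] := rat_near z.2.
  exists (p1, p2) => //; rewrite /F ifT; first by split; rewrite /= in_itv.
  apply/asboolP => y [/=]; rewrite !in_itv/= => y1 y2.
  by apply: eU; split; [exact: p1e|exact: p2e].
apply: countable_bigcupT_measurable; first exact: countableP.
by move=> i; rewrite /F; case: ifP => _ //; exact: measurableX.
Qed.

Lemma lebesgue_translate (c : R) (A : set line) : measurable A ->
  mu ((fun x : R => x + c) @^-1` A) = mu A.
Proof.
pose g : line -> line := fun x : R => x + c.
have mg : measurable_fun [set: line] g by exact: measurable_funD.
pose f : {mfun line >-> line} := HB.pack g (isMeasurableFun.Build _ _ line line g mg).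
move=> mA; rewrite [RHS](@lebesgue_measure_unique R (pushforward mu f))// => X [[a b] _ <-].
have E : g @^-1` `]a, b]%classic = `]a - c, b - c]%classic.
  by apply/seteqP; split=> x /=; rewrite !in_itv/= /g ltrBlDr lerBrDr.
rewrite -[RHS]/(mu (g @^-1` `]a, b]%classic)) E.
rewrite !lebesgue_measure_itv/= !lte_fin ltrD2r; case: ifP => // _.
by rewrite -!EFinB; congr EFin; ring.
Qed.

Definition shear (X : R -> R) (z : plane) : plane := (z.1 + X z.2, z.2).

Lemma measurable_shear X : measurable_fun setT (X : line -> line) ->
  measurable_fun setT (shear X).
Proof.
move=> mX; apply/measurable_fun_pairP; split; last exact: measurable_snd.
by apply: measurable_funD; [exact: measurable_fst|exact: measurableT_comp].
Qed.

(** Integrating the lengths of horizontal slices yields the same measure, by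
    uniqueness of the product measure. *)
Lemma lebesgue2_ysection (A : set plane) : measurable A ->
  mu2 A = (\int[mu]_t mu (ysection A t))%E.
Proof.
move=> mA; rewrite (product_measure_unique (m' := (mu \x^ mu)%E))//.
by move=> B C mB mC; exact: product_measure2E.
Qed.

(** Each horizontal slice of the preimage is a translate of a slice of [A]. *)
Lemma lebesgue2_shear X (A : set plane) : measurable_fun setT (X : line -> line) ->
  measurable A -> mu2 (shear X @^-1` A) = mu2 A.
Proof.
move=> mX mA; have mS : measurable (shear X @^-1` A).
  by rewrite -[X in measurable X]setTI; exact: measurable_shear.
rewrite !lebesgue2_ysection//; apply: eq_integral => t _.
rewrite -(lebesgue_translate (X t) (measurable_ysection t mA)); congr (mu _).
Qed.

Lemma integral_pushforward_shear X (f : plane -> \bar R) :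
  measurable_fun setT (X : line -> line) ->
  (\int[pushforward mu2 (shear X)]_z f z = \int[mu2]_z f z)%E.
Proof.
move=> mX.
(* The image measure is named with its structure, which depends on a proof that
   the shear is measurable. *)
pose nu := measure_function_pushforward__canonical__measure_function_Measure
  mu2 (measurable_shear mX).
have E : forall A, measurable A -> A `<=` [set: plane] -> nu A = mu2 A.
  by move=> A mA _; exact: lebesgue2_shear.
exact: (@eq_measure_integral _ plane R setT mu2 nu f E).
Qed.

Lemma integrable_shear X (h : plane -> R) : measurable_fun setT (X : line -> line) ->
  mu2.-integrable setT (EFin \o h) ->
  mu2.-integrable setT (EFin \o (h \o shear X)).
Proof.
move=> mX /integrableP[mh hoo]; have mS := measurable_shear mX.
apply/integrableP; split; first exact: measurableT_comp mh mS.
have mnh : measurable_fun setT (fun z : plane => `|(h z)%:E|%E).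
  exact: measurableT_comp mh.
have := @ge0_integral_pushforward _ _ _ _ _ _ mS mu2 setT _ measurableT mnh
  (fun z _ => abse_ge0 _).
rewrite preimage_setT => <-.
by rewrite integral_pushforward_shear.
Qed.

Lemma Rintegral_shear X (h : plane -> R) : measurable_fun setT (X : line -> line) ->
  mu2.-integrable setT (EFin \o h) ->
  \int[mu2]_z h z = \int[mu2]_z h (shear X z).
Proof.
move=> mX hint; have mS := measurable_shear mX.
have mh : measurable_fun setT (EFin \o h) by case/integrableP : hint.
have hs : mu2.-integrable (shear X @^-1` setT) ((EFin \o h) \o shear X).
  by rewrite preimage_setT; exact: integrable_shear.
have := integral_pushforward mS mh hs measurableT; rewrite preimage_setT => E.
rewrite /Rintegral.
have P := integral_pushforward_shear (EFin \o h) mX.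
by rewrite P in E; rewrite [X in fine X = _]E.
Qed.

End PlaneMeasure.

(** * Test functions *)

Section TestFunctions.
Context {R : realType}.
Notation mu := (@lebesgue_measure R).
Notation line := (measurableTypeR R).
Notation plane := (measurableTypeR R * measurableTypeR R)%type.
Implicit Types phi : R * R -> R.

Lemma continuous_measurable_plane (f : R * R -> R) : continuous f ->
  measurable_fun [set: plane] (f : plane -> line).
Proof.
move=> /continuousP cf; apply: (measurability _ (RGenOpens.measurableE R)).
move=> _ [_ [a [b ->] <-]]; rewrite setTI; apply: open_measurable_plane.
exact/cf/interval_open.
Qed.

Lemma smooth_continuous phi : smooth phi -> continuous phi.
Proof. by move=> sphi z; apply: differentiable_continuous; exact: (sphi [::] z). Qed.

Lemma smooth_continuous_derive phi v : smooth phi -> continuous ('D_v phi).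
Proof. by move=> sphi z; apply: differentiable_continuous; exact: (sphi [:: v] z). Qed.

(** The directional derivatives along the axes are the derivatives of the
    one-variable slices. *)
Lemma smooth_C1 phi : smooth phi ->
  C1_with (fun x t => phi (x, t)) (fun x t => 'D_(1, 0) phi (x, t))
    (fun x t => 'D_(0, 1) phi (x, t)).
Proof.
move=> sphi; split.
- move=> x t.
  have dphi : derivable phi (x, t) (1, 0) by apply: diff_derivable; exact: (sphi [::]).
  have E : (fun h : R => h^-1 *: ((phi \o shift (x, t)) (h *: (1, 0)) - phi (x, t))) =
      (fun h : R => h^-1 *: (((fun s : R => phi (s, t)) \o shift x) (h *: 1) - phi (x, t))).
    apply/funext => h /=; congr (_ *: (phi _ - _)).
    by rewrite [LHS](_ : _ = (h *: 1 + x, h *: 0 + t))// scaler0 add0r.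
  split.
    by move: dphi; rewrite /derivable E.
  by rewrite /derive -E.
- move=> x t.
  have dphi : derivable phi (x, t) (0, 1) by apply: diff_derivable; exact: (sphi [::]).
  have E : (fun h : R => h^-1 *: ((phi \o shift (x, t)) (h *: (0, 1)) - phi (x, t))) =
      (fun h : R => h^-1 *: (((fun s : R => phi (x, s)) \o shift t) (h *: 1) - phi (x, t))).
    apply/funext => h /=; congr (_ *: (phi _ - _)).
    by rewrite [LHS](_ : _ = (h *: 0 + x, h *: 1 + t))// scaler0 add0r.
  split.
    by move: dphi; rewrite /derivable E.
  by rewrite /derive -E.
- have -> : (fun z : R * R => 'D_(1, 0) phi (z.1, z.2)) = 'D_(1, 0) phi.
    by apply/funext => -[].
  exact: smooth_continuous_derive.
- have -> : (fun z : R * R => 'D_(0, 1) phi (z.1, z.2)) = 'D_(0, 1) phi.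
    by apply/funext => -[].
  exact: smooth_continuous_derive.
Qed.

Definition supported_in_box (M : R) (g : R * R -> R) :=
  forall z, M < `|z.1| \/ M < `|z.2| -> g z = 0.

(** Outside the closure of its support [phi] vanishes in a neighbourhood, hence
    so do its derivatives. *)
Lemma test_function_support phi v : test_function phi -> exists M,
  [/\ 0 < M, supported_in_box M phi & supported_in_box M ('D_v phi)].
Proof.
move=> [_ /compact_bounded[M [_ hM]]].
have out z : Num.max M 0 + 1 < `|z.1| \/ Num.max M 0 + 1 < `|z.2| ->
    ~ closure [set z : R * R | phi z != 0] z.
  move=> zM cz; have := hM (Num.max M 0 + 1); rewrite ltr_pwDr ?le_max ?lexx//.
  move=> /(_ isT z cz) /=; rewrite prod_normE/= ge_max => /andP[z1 z2].
  by case: zM; rewrite ltNge ?z1 ?z2.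
exists (Num.max M 0 + 1); split.
- by rewrite ltr_pwDr// le_max lexx orbT.
- move=> z /out; apply: contra_notP => /eqP pz; exact: subset_closure.
- move=> z /out nz; rewrite -(derive_cst (0 : R) z v); apply: near_eq_derive.
  have : nbhs z (~` closure [set z : R * R | phi z != 0]).
    apply: open_nbhs_nbhs; split => //; rewrite openC; exact: closed_closure.
  apply: filterS => y; apply: contra_notP => /eqP py; exact: subset_closure.
Qed.

Lemma supported_in_box_le (M N : R) g : M <= N -> supported_in_box M g ->
  supported_in_box N g.
Proof. by move=> MN gM z zN; apply: gM; case: zN => ?; [left|right]; lra. Qed.

Lemma supported_bounded (M : R) g : continuous g -> supported_in_box M g ->
  exists C, 0 <= C /\ forall z, `|g z| <= C.
Proof.
move=> gc gM.
have cbox : compact (`[- M, M] `*` `[- M, M] : set (R * R)).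
  by apply: compact_setX; exact: segment_compact.
have [C [_ hC]] := compact_bounded (continuous_compact (continuous_subspaceT gc) cbox).
exists (Num.max C 0 + 1); split=> [|z]; first by rewrite addr_ge0// le_max lexx orbT.
have [z1|z1] := ltP M `|z.1|.
  by rewrite gM ?normr0 ?addr_ge0 ?le_max ?lexx ?orbT//; left.
have [z2|z2] := ltP M `|z.2|.
  by rewrite gM ?normr0 ?addr_ge0 ?le_max ?lexx ?orbT//; right.
apply: hC; first by rewrite ltr_pwDr ?le_max ?lexx.
by exists z => //; split; rewrite /= in_itv/= -ler_norml.
Qed.

End TestFunctions.

(** * Integrability on strips and differentiation along a curve *)

Section Transport.
Context {R : realType}.
Notation mu := (@lebesgue_measure R).
Notation mu2 := (mu \x mu)%E.
Notation line := (measurableTypeR R).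
Notation plane := (measurableTypeR R * measurableTypeR R)%type.
Implicit Types phi : R * R -> R.

Lemma measurable_fun_snd (p : R -> R) : measurable_fun setT (p : line -> line) ->
  measurable_fun [set: plane] (fun z : plane => p z.2 : line).
Proof. by move=> mp; apply: measurableT_comp mp measurable_snd. Qed.

Lemma measurable_fun_fst (p : R -> R) : measurable_fun setT (p : line -> line) ->
  measurable_fun [set: plane] (fun z : plane => p z.1 : line).
Proof. by move=> mp; apply: measurableT_comp mp measurable_fst. Qed.

Lemma integrable_measurable (p : R -> R) : mu.-integrable setT (EFin \o p) ->
  measurable_fun setT (p : line -> line).
Proof. by move=> /integrableP[/measurable_EFinP]. Qed.

(** By Tonelli the integral of the absolute value is a product of two
    integrals. *)
Lemma integrable_tensor (p q : R -> R) :
  mu.-integrable setT (EFin \o p) -> mu.-integrable setT (EFin \o q) ->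
  mu2.-integrable setT (fun z : plane => (q z.1 * p z.2)%:E).
Proof.
move=> ip iq.
have mp := integrable_measurable ip; have mq := integrable_measurable iq.
have mpq : measurable_fun [set: plane] (fun z : plane => (q z.1 * p z.2)%:E).
  apply/measurable_EFinP; apply: measurable_funM.
    exact: measurable_fun_fst.
  exact: measurable_fun_snd.
have /integrableP[_ fp] := ip; have /integrableP[_ fq] := iq.
apply: (@integrable12ltyP _ _ line line R mu mu _ mpq).2.
rewrite (eq_integral (fun x : line => `|(q x)%:E| * \int[mu]_y `|(p y)%:E|)%E); last first.
  move=> x _; rewrite -ge0_integralZl//.
  - by apply: eq_integral => y _; rewrite EFinM abseM.
  - by apply: measurableT_comp => //; exact/measurable_EFinP.
rewrite ge0_integralZr//.
- by rewrite lte_mul_pinfty ?integral_ge0// ge0_fin_numE ?integral_ge0.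
- by apply: measurableT_comp => //; exact/measurable_EFinP.
- exact: integral_ge0.
Qed.

(** The product is dominated by the tensor product of [p] with a multiple of the
    indicator of [[- M, M]]. *)
Lemma integrable_strip (p : R -> R) (g : plane -> R) (M C : R) :
  mu.-integrable setT (EFin \o p) -> measurable_fun setT (g : plane -> line) ->
  (forall z, `|g z| <= C) -> (forall z, M < `|z.1| -> g z = 0) ->
  mu2.-integrable setT (fun z : plane => (p z.2 * g z)%:E).
Proof.
move=> ip mg gC gM; have mp := integrable_measurable ip.
have C0 : 0 <= C := le_trans (normr_ge0 _) (gC (0, 0)).
have iq : mu.-integrable setT (EFin \o (fun x => C * \1_`[- M, M] x)).
  by apply: integrableZl (integrable_indic_itv _ _ _ _).
apply: le_integrable (integrable_tensor ip iq) => //.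
  apply/measurable_EFinP; apply: measurable_funM => //; exact: measurable_fun_snd.
move=> z _; rewrite !abse_EFin lee_fin.
have [zM|zM] := ltP M `|z.1|; first by rewrite gM// mulr0 normr0.
rewrite indicE mem_set/= ?in_itv/= -?ler_norml// mulr1 !normrM mulrC.
by rewrite ler_wpM2r// (ger0_norm C0).
Qed.

Lemma L1loc_restrict (p : R -> R) (T : R) : L1loc_half_line p ->
  mu.-integrable setT (EFin \o (p \_ `[0, T])).
Proof.
move=> /(_ T) pT; rewrite -restrict_EFin.
by apply/integrable_restrict => //=; rewrite setTI.
Qed.

Lemma L1loc_cst (c : R) : L1loc_half_line (fun _ : R => c).
Proof.
move=> T; apply: continuous_compact_integrable; first exact: segment_compact.
by apply: continuous_subspaceT => x; exact: cvg_cst.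
Qed.

Lemma L1loc_eq (f g : R -> R) : (forall t, 0 <= t -> f t = g t) ->
  L1loc_half_line f -> L1loc_half_line g.
Proof.
move=> fg fl T; apply: eq_integrable (fl T) => // t.
by rewrite inE/= in_itv/= => /andP[t0 _]; rewrite /= fg.
Qed.

Lemma L1locM_antiderivative (n m f : R -> R) : antiderivative n m ->
  L1loc_half_line f -> L1loc_half_line (fun t => m t * f t).
Proof.
move=> nm fl; apply: L1loc_eq (L1locM_continuous (antiderivative_continuous nm) fl).
by move=> t t0; rewrite (max_idPr t0).
Qed.

Lemma antiderivative_id : antiderivative (fun=> 1) (@id R).
Proof.
split=> [|t t0]; first exact: L1loc_cst.
rewrite Rintegral_cst//= lebesgue_measure_itv/= add0r mul1r lte_fin.
by case: ltP => [t1|t1] /=; [rewrite subr0|apply/eqP; rewrite eq_le t0 t1].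
Qed.

Lemma antiderivative_shift (a X : R -> R) (y : R) : antiderivative a X ->
  antiderivative a (fun t => y + X t).
Proof. by move=> [al aX]; split=> // t t0; rewrite (aX t)// addrA. Qed.

Lemma C1_mul : @C1_with R (fun x y => x * y) (fun _ y => y) (fun x _ => x).
Proof.
split=> [x y|x y|z|z].
- have -> : (fun x : R => x * y) = y *: id by apply/funext => t; rewrite /= mulrC.
  by rewrite -[X in is_derive _ _ _ X]mulr1; exact: is_deriveZ.
- have -> : (fun y : R => x * y) = x *: id by [].
  by rewrite -[X in is_derive _ _ _ X]mulr1; exact: is_deriveZ.
- exact: cvg_snd.
- exact: cvg_fst.
Qed.

(** The chain rule for [phi] along [t |-> (y + X t, t)], followed by the chain
    rule for the product with [m]. *)
Lemma antiderivative_along (a X n m : R -> R) (y : R) phi : smooth phi ->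
  antiderivative a X -> antiderivative n m ->
  antiderivative
    (fun t => m t * 'D_(0, 1) phi (y + X t, t) + m t * a t * 'D_(1, 0) phi (y + X t, t)
              + n t * phi (y + X t, t))
    (fun t => m t * phi (y + X t, t)).
Proof.
move=> sphi aX nm.
have := chain_rule C1_mul nm
  (chain_rule (smooth_C1 sphi) (antiderivative_shift y aX) antiderivative_id).
set f := (fun t => _); set g := (X in _ -> antiderivative X _).
by have -> : f = g by apply/funext => t; rewrite /f /g; ring.
Qed.

End Transport.

(** * The transport identity *)

Section TransportIdentity.
Context {R : realType}.
Notation mu := (@lebesgue_measure R).
Notation mu2 := (mu \x mu)%E.
Notation line := (measurableTypeR R).
Notation plane := (measurableTypeR R * measurableTypeR R)%type.
Variables (a X n m : R -> R) (S : set line).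
Hypotheses (aX : antiderivative a X) (X0 : X 0 = 0) (nm : antiderivative n m).
Hypothesis mS : measurable S.

Let X' t := X (Num.max 0 t).

Let mX' : measurable_fun setT (X' : line -> line).
Proof. exact: continuous_measurable_fun (antiderivative_continuous aX). Qed.

Let side (z : plane) : R := \1_S (z.1 - X' z.2).

Let mside : measurable_fun setT (side : plane -> line).
Proof.
apply: (measurableT_comp (f := \1_S : line -> line)); first exact: measurable_indic.
by apply: measurable_funB; [exact: measurable_fst|exact: measurable_fun_snd].
Qed.

Let side_le1 z : `|side z| <= 1.
Proof. by rewrite /side indicE; case: (_ \in _); rewrite ?normr1 ?normr0. Qed.

Lemma region_L1loc (p : R -> R) : L1loc_half_line p ->
  L1loc_half_plane (fun x t => \1_S (x - X t) * p t).
Proof.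
move=> pl r.
have box : measurable (`[- r, r] `*` `[0, r] : set plane) by exact: measurableX.
pose g (z : plane) := side z * \1_(`[- r, r] : set R) z.1.
have := @integrable_strip R (p \_ `[0, r]) g r 1 (L1loc_restrict r pl).
have mg : measurable_fun setT (g : plane -> line).
  apply: measurable_funM => //; apply: measurable_fun_fst; exact: measurable_indic.
have g1 z : `|g z| <= 1.
  rewrite /g normrM -[leRHS]mul1r ler_pM// ?side_le1// indicE.
  by case: (_ \in _); rewrite ?normr1 ?normr0.
have gr (z : plane) : r < `|z.1| -> g z = 0.
  move=> rz; rewrite /g indicE memNset ?mulr0//= in_itv/= -ler_norml.
  by apply/negP; rewrite -ltNge.
move=> /(_ mg g1 gr) /(integrableS measurableT box (@subsetT _ _)).
apply: eq_integrable => // -[x t]; rewrite inE => -[/= xr]; rewrite in_itv/= => /andP[t0 tr].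
rewrite patchE mem_set/= ?in_itv/= ?t0// /g /= indicE mem_set//= mulr1 /side/= /X'.
by rewrite (max_idPr t0) mulrC.
Qed.

(** In the sheared coordinate [y = x - X t] the integrand [F] is [\1_S y] times
    the derivative of [t |-> m t * phi (y + X t, t)], which vanishes for large
    [t]; only the boundary term at [t = 0] is left. *)
Lemma transport_identity phi : test_function phi ->
  let F (z : plane) := \1_S (z.1 - X z.2) *
    (m z.2 * 'D_(0, 1) phi z + m z.2 * a z.2 * 'D_(1, 0) phi z + n z.2 * phi z) in
  let g x := m 0 * \1_S x * phi (x, 0) in
  [/\ lebesgue2.-integrable half_plane (EFin \o F),
      mu.-integrable setT (EFin \o g) &
      \int[lebesgue2]_(z in half_plane) F z = - \int[mu]_x g x].
Proof.
move=> tphi F g; have sphi := tphi.1.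
have [M1 [M10 supp1 suppt1]] := test_function_support (0, 1) tphi.
have [M2 [M20 _ suppx2]] := test_function_support (1, 0) tphi.
pose M := Num.max M1 M2.
have M0 : 0 < M by rewrite lt_max M10.
have supp : supported_in_box M phi by apply: supported_in_box_le supp1; rewrite le_max lexx.
have suppt : supported_in_box M ('D_(0, 1) phi).
  by apply: supported_in_box_le suppt1; rewrite le_max lexx.
have suppx : supported_in_box M ('D_(1, 0) phi).
  by apply: supported_in_box_le suppx2; rewrite le_max lexx orbT.
(* Beyond [M] in time everything vanishes, in particular at time [M + 1]. *)
pose T := M + 1.
pose p1 := m \_ `[0, T]; pose p2 := (fun t => m t * a t) \_ `[0, T].
pose p3 := n \_ `[0, T].
(* [h] extends [F] by zero to [t < 0]; its coefficients are cut off to [[0, T]],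
   hence integrable on the whole line. *)
pose h (z : plane) := p1 z.2 * (side z * 'D_(0, 1) phi z)
  + p2 z.2 * (side z * 'D_(1, 0) phi z) + p3 z.2 * (side z * phi z).
have [al _] := aX; have [nl _] := nm.
have ml : L1loc_half_line m.
  by apply: L1loc_eq (L1locM_antiderivative nm (L1loc_cst 1)) => t _; rewrite mulr1.
have strip p (q : R * R -> R) : L1loc_half_line p -> continuous q -> supported_in_box M q ->
    mu2.-integrable setT (fun z : plane => ((p \_ `[0, T]) z.2 * (side z * q z))%:E).
  move=> pl qc qM; have [C [C0 qC]] := supported_bounded qc qM.
  apply: (@integrable_strip _ _ _ M C) => //.
  - exact: L1loc_restrict.
  - by apply: measurable_funM => //; exact: continuous_measurable_plane.
  - by move=> z; rewrite normrM -[leRHS]mul1r ler_pM.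
  - by move=> z zM; rewrite (qM z) ?mulr0//; left.
have hint : mu2.-integrable setT (EFin \o h).
  have i1 := strip _ _ ml (smooth_continuous_derive (v := (0, 1)) sphi) suppt.
  have i2 := strip _ _ (L1locM_antiderivative nm al)
    (smooth_continuous_derive (v := (1, 0)) sphi) suppx.
  have i3 := strip _ _ nl (smooth_continuous sphi) supp.
  exact: integrableD (integrableD _ i1 i2) i3.
have Fh : F \_ half_plane = h.
  apply/funext => -[x t]; rewrite patchE /h /p1 /p2 /p3 !patchE/=.
  have [t0|t0] := ltP t 0.
    rewrite memNset; last by move=> [_ /=]; rewrite in_itv/= andbT leNgt t0.
    by rewrite memNset ?mul0r ?addr0//= in_itv/= leNgt t0.
  rewrite mem_set; last by split => //=; rewrite in_itv/= t0.
  rewrite /F /side /= /X' (max_idPr t0).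
  have [tT|tT] := leP t T; first by rewrite mem_set/= ?in_itv/= ?t0//; ring.
  have tM : M < `|(x, t).2| by rewrite /= ger0_norm//; move: tT; rewrite /T; lra.
  rewrite (suppt _ (or_intror tM)) (suppx _ (or_intror tM)) (supp _ (or_intror tM)).
  by rewrite !mulr0 !addr0 mulr0.
have hp : measurable (half_plane : set plane) by apply: measurableX.
suff [gint hE] : mu.-integrable setT (EFin \o g) /\
    \int[lebesgue2]_z h z = - \int[mu]_x g x.
  split => //; last by rewrite Rintegral_mkcond Fh.
  by apply/(integrable_mkcond _ hp); rewrite -/lebesgue2 restrict_EFin Fh.
have hsh := integrable_shear mX' hint.
have -> : \int[lebesgue2]_z h z = \int[mu2]_z h (shear X' z) := Rintegral_shear mX' hint.
pose k (z : plane) := h (shear X' z).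
(* [r y] is the derivative of [t |-> m t * phi (y + X t, t)]. *)
pose r y t := m t * 'D_(0, 1) phi (y + X t, t) + m t * a t * 'D_(1, 0) phi (y + X t, t)
  + n t * phi (y + X t, t).
have kE y t : k (y, t) = \1_S y * (r y \_ `[0, T]) t.
  rewrite /k /h /shear /side /p1 /p2 /p3 /= addrK !patchE.
  case: ifPn => [|_]; last by rewrite !mul0r !addr0 mulr0.
  rewrite inE/= in_itv/= => /andP[t0 _]; rewrite /X' (max_idPr t0) /r; ring.
have inner y : (\int[mu]_t (k (y, t))%:E = (- (m 0 * \1_S y * phi (y, 0)))%:E)%E.
  have rP := antiderivative_along y sphi aX nm.
  have rint := L1loc_restrict T rP.1.
  have T0 : 0 <= T by rewrite /T addr_ge0// ltW.
  have out : phi (y + X T, T) = 0.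
    by apply: supp; right; rewrite /= ger0_norm// /T ltrDl.
  have intr : \int[mu]_t (r y \_ `[0, T]) t = - (m 0 * phi (y, 0)).
    rewrite -Rintegral_mkcond; have := rP.2 T T0; rewrite out mulr0 X0 addr0 -/(r y).
    by move=> /esym/eqP; rewrite addrC addr_eq0 => /eqP.
  have -> : (\int[mu]_t (k (y, t))%:E)%E = (\int[mu]_t (\1_S y * (r y \_ `[0, T]) t)%:E)%E.
    by apply: eq_integral => t _; rewrite kE.
  rewrite -[LHS]fineK; last first.
    by apply: integrable_fin_num => //; exact: integrableZl rint.
  rewrite -[fine _]/(\int[mu]_t (\1_S y * (r y \_ `[0, T]) t)) RintegralZl// intr.
  by congr EFin; ring.
have gN : mu.-integrable setT (EFin \o (fun y => - g y)).
  have := integrable_fubini_F hsh; apply: eq_integrable => // y _; exact: inner.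
have gint : mu.-integrable setT (EFin \o g).
  by have := integrableN gN; apply: eq_integrable => // y _; rewrite /= opprK.
split=> //; rewrite [LHS]/Rintegral -integral12_prod_meas1//.
rewrite [X in fine X](eq_integral (fun y => (- g y)%:E))//; last first.
  by move=> y _; exact: inner.
rewrite -[LHS]/(\int[mu]_y (- g y)) -[RHS]mulN1r -RintegralZl//.
by apply: eq_Rintegral => y _; rewrite mulN1r.
Qed.

End TransportIdentity.

(** * Balance laws carried by two moving regions *)

Section TwoRegions.
Context {R : realType}.
Notation mu := (@lebesgue_measure R).
Notation line := (measurableTypeR R).
Notation plane := (measurableTypeR R * measurableTypeR R)%type.

Lemma L1loc_half_plane_eq (v w : R -> R -> R) :
  (forall x t, 0 <= t -> v x t = w x t) -> L1loc_half_plane v -> L1loc_half_plane w.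
Proof.
move=> vw vl r; have : measurable (`[- r, r] `*` `[0, r] : set plane) by exact: measurableX.
move=> mb; apply: eq_integrable (vl r) => // -[x t]; rewrite inE => -[_ /=].
by rewrite in_itv/= => /andP[t0 _]; rewrite vw.
Qed.

Lemma L1loc_half_planeD (v w : R -> R -> R) : L1loc_half_plane v ->
  L1loc_half_plane w -> L1loc_half_plane (fun x t => v x t + w x t).
Proof.
move=> vl wl r; have mb : measurable (`[- r, r] `*` `[0, r] : set plane) by exact: measurableX.
exact: (@integrableD _ plane R (mu \x mu)%E _ mb _ _ (vl r) (wl r)).
Qed.

(** The initial data may differ from the traces of the two regions at the single
    point 0, as [riemann_data] does. *)
Lemma weak_balance_law_two_regions (SL SR : set line)
    (aL XL nL mL aR XR nR mR : R -> R) (w f g : R -> R -> R) (w0 : R -> R) :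
  measurable SL -> measurable SR ->
  antiderivative aL XL -> XL 0 = 0 -> antiderivative nL mL ->
  antiderivative aR XR -> XR 0 = 0 -> antiderivative nR mR ->
  (forall x t, 0 <= t -> w x t = \1_SL (x - XL t) * mL t + \1_SR (x - XR t) * mR t) ->
  (forall x t, 0 <= t -> f x t = \1_SL (x - XL t) * (mL t * aL t)
                                + \1_SR (x - XR t) * (mR t * aR t)) ->
  (forall x t, 0 <= t -> g x t = \1_SL (x - XL t) * nL t + \1_SR (x - XR t) * nR t) ->
  measurable_fun setT (w0 : line -> line) ->
  (forall x, x != 0 -> w0 x = mL 0 * \1_SL x + mR 0 * \1_SR x) ->
  weak_balance_law w f g w0.
Proof.
move=> mSL mSR aXL XL0 nmL aXR XR0 nmR wE fE gE mw0 w0E.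
have mL1 (n m : R -> R) : antiderivative n m -> L1loc_half_line m.
  by move=> nm; apply: L1loc_eq (L1locM_antiderivative nm (L1loc_cst 1)) => t _; rewrite mulr1.
split.
- apply: (L1loc_half_plane_eq (fun x t t0 => esym (wE x t t0))).
  apply: L1loc_half_planeD; first exact: (region_L1loc aXL mSL (mL1 _ _ nmL)).
  exact: (region_L1loc aXR mSR (mL1 _ _ nmR)).
- apply: (L1loc_half_plane_eq (fun x t t0 => esym (fE x t t0))).
  apply: L1loc_half_planeD.
    exact: (region_L1loc aXL mSL (L1locM_antiderivative nmL aXL.1)).
  exact: (region_L1loc aXR mSR (L1locM_antiderivative nmR aXR.1)).
- apply: (L1loc_half_plane_eq (fun x t t0 => esym (gE x t t0))).
  apply: L1loc_half_planeD; first exact: (region_L1loc aXL mSL nmL.1).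
  exact: (region_L1loc aXR mSR nmR.1).
move=> phi tphi.
have [FLi gLi EL] := transport_identity aXL XL0 nmL mSL tphi.
have [FRi gRi ER] := transport_identity aXR XR0 nmR mSR tphi.
have hp : measurable (half_plane : set plane) by exact: measurableX.
rewrite (@eq_Rintegral _ plane R lebesgue2 half_plane (fun z =>
    \1_SL (z.1 - XL z.2) * (mL z.2 * 'D_(0, 1) phi z
      + mL z.2 * aL z.2 * 'D_(1, 0) phi z + nL z.2 * phi z)
  + \1_SR (z.1 - XR z.2) * (mR z.2 * 'D_(0, 1) phi z
      + mR z.2 * aR z.2 * 'D_(1, 0) phi z + nR z.2 * phi z))); last first.
  move=> z; rewrite inE => -[_ /=]; rewrite in_itv/= andbT => t0.
  by rewrite wE// fE// gE//; ring.
rewrite (@RintegralD _ plane R (mu \x mu)%E half_plane _ _ hp FLi FRi) EL ER.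
have -> : \int[mu]_x (w0 x * phi (x, 0)) =
    \int[mu]_x (mL 0 * \1_SL x * phi (x, 0) + mR 0 * \1_SR x * phi (x, 0)).
  congr fine; apply: ae_eq_integral => //.
  - apply/measurable_EFinP; apply: measurable_funM => //.
    apply: continuous_measurable_fun => x.
    apply: (@continuous_comp _ _ _ (fun x : R => (x, 0 : R)) phi).
      exact: (cvg_pair cvg_id (cvg_cst _)).
    exact: smooth_continuous tphi.1 _.
  - by case/integrableP: (integrableD measurableT gLi gRi).
  (* Both sides agree except possibly at 0. *)
  - exists [set 0]; split; [exact: measurable_set1|exact: lebesgue_measure_set1|].
    move=> x /= nx; apply: contrapT => /eqP x0; apply: nx => _.
    by rewrite w0E// mulrDl.
by rewrite RintegralD// -opprD addrC addrN.
Qed.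

End TwoRegions.

(** * The vacuum solution *)

Section VacuumSolutionFacts.
Context {R : realType}.
Notation mu := (@lebesgue_measure R).
Notation line := (measurableTypeR R).
Notation plane := (measurableTypeR R * measurableTypeR R)%type.

(** The two non-vacuum regions in the coordinate [y = x - X t]; both are open,
    because the vacuum is closed. *)
Definition leftward : set line := `]-oo, 0[%classic.
Definition rightward : set line := `]0, +oo[%classic.

Lemma antiderivativeZ (k : R) (f F : R -> R) : antiderivative f F ->
  antiderivative (fun t => k * f t) (fun t => k * F t).
Proof.
move=> [fl fF]; split=> [|t t0]; first exact: L1locZ.
by rewrite (fF t)// mulrDr RintegralZl.
Qed.

Lemma antiderivative_cst (c : R) : antiderivative (fun=> 0) (fun=> c).
Proof.
split=> [|t t0]; first exact: L1loc_cst.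
by rewrite Rintegral_cst// mul0r addr0.
Qed.

Lemma C1_expN : @C1_with R (fun x _ => expR (- x)) (fun x _ => - expR (- x)) (fun _ _ => 0).
Proof.
have cexp : continuous (fun x : R => expR (- x)).
  move=> x; apply: continuous_comp; first exact: opp_continuous.
  exact: continuous_expR.
split=> [x y|x y|z|z].
- rewrite -[- expR _]mulr1 mulNr -mulrN.
  exact: (@is_derive1_comp R expR -%R x _ _ (is_derive_expR _) (is_deriveNid x 1)).
- exact: is_derive_cst.
- apply: cvgN; apply: (@continuous_comp _ _ _ fst (fun x : R => expR (- x))).
    exact: cvg_fst.
  exact: cexp.
- exact: cvg_cst.
Qed.

Variables (alpha sigma : R -> R) (rhoL uL rhoR uR : R).
Hypotheses (alpha_loc : L1loc_half_line alpha) (alpha_ge0 : nonneg_ae alpha).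
Hypotheses (sigma_loc : L1loc_half_line sigma) (uLR : uL < uR).
Notation D := (damping sigma).
Notation A := (amplitude alpha sigma).
Notation rho := (vacuum_density alpha sigma rhoL uL rhoR uR).
Notation u := (vacuum_velocity alpha sigma uL uR).

Lemma damping_antiderivative : antiderivative (fun t => - (sigma t * D t)) D.
Proof.
have := chain_rule C1_expN (antiderivative_integral sigma_loc) antiderivative_id.
set f := (fun t => _); set g := (X in _ -> antiderivative X _).
by have -> : f = g by apply/funext => t; rewrite /f /g /damping; ring.
Qed.

Lemma damping0 : D 0 = 1.
Proof. by rewrite /damping set_itv1 Rintegral_set1 oppr0 expR0. Qed.

Lemma flux_L1loc : L1loc_half_line (fun t => alpha t * D t).
Proof.
apply: L1loc_eq (L1locM_antiderivative damping_antiderivative alpha_loc) => t _.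
by rewrite mulrC.
Qed.

Lemma amplitude_antiderivative : antiderivative (fun t => alpha t * D t) A.
Proof. exact: antiderivative_integral flux_L1loc. Qed.

Lemma amplitude0 : A 0 = 0.
Proof. by rewrite /amplitude set_itv1 Rintegral_set1. Qed.

(** The integrand is almost everywhere equal to its absolute value. *)
Lemma amplitude_ge0 t : 0 <= A t.
Proof.
have /integrableP[mf _] := flux_L1loc t.
rewrite /amplitude /Rintegral (ae_eq_integral (fun s : line => `|alpha s * D s|%:E))//.
- by apply: fine_ge0; apply: integral_ge0 => s _; rewrite lee_fin.
- by apply/measurable_EFinP; apply: measurableT_comp => //; exact/measurable_EFinP.
have [N [mN N0 subN]] := alpha_ge0; exists N; split=> // s /= ns.
apply: subN => /= s0; apply: ns; rewrite in_itv/= => /andP[/s0 as0 _].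
by rewrite ger0_norm// mulr_ge0// expR_ge0.
Qed.

Lemma measurable_fun_clamp f F : antiderivative f F ->
  measurable_fun [set: plane] (fun z : plane => F (Num.max 0 z.2) : line).
Proof.
move=> fF; apply: (@measurable_fun_snd R (fun t : R => F (Num.max 0 t))).
exact: continuous_measurable_fun (antiderivative_continuous fF).
Qed.

Lemma measurable_vacuum_velocity : measurable_fun (half_plane : set plane)
  (fun z : plane => u z.1 z.2).
Proof.
pose A' (z : plane) := A (Num.max 0 z.2); pose D' (z : plane) := D (Num.max 0 z.2).
have mA : measurable_fun setT (A' : plane -> line).
  exact: measurable_fun_clamp amplitude_antiderivative.
have mD : measurable_fun setT (D' : plane -> line).
  exact: measurable_fun_clamp damping_antiderivative.
have mx : measurable_fun [set: plane] (fst : plane -> line) by exact: measurable_fst.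
(* Inverses of nonnegative numbers are powers of exponent [-1], and power
   functions are measurable. *)
have mAV : measurable_fun [set: plane] (fun z => (A' z)^-1 : line).
  have -> : (fun z => (A' z)^-1) = (fun z => A' z `^ (-1)).
    by apply/funext => z; rewrite powR_inv1// amplitude_ge0.
  by apply: (measurableT_comp (f := fun x : R => x `^ (-1))) => //; exact: measurable_powR.
have mc (c : R) (g : plane -> line) : measurable_fun setT g ->
    measurable_fun setT (fun z => c * g z : line).
  by move=> mg; apply: measurable_funM => //; exact: measurable_cst.
have : measurable_fun setT (fun z : plane => (if z.1 < uL * A' z then uL * D' z
    else if z.1 <= uR * A' z then z.1 / A' z * D' z else uR * D' z) : line).
  apply: measurable_fun_ifT.
  - by apply: measurable_fun_ltr => //; exact: mc.
  - exact: mc.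
  apply: measurable_fun_ifT.
  - by apply: measurable_fun_ler => //; exact: mc.
  - by apply: measurable_funM => //; exact: measurable_funM.
  - exact: mc.
move=> mv; have : measurable_fun (half_plane : set plane) _ := measurable_funTS mv.
apply: eq_measurable_fun => z.
rewrite inE => -[_ /=]; rewrite in_itv/= andbT => t0.
by rewrite /vacuum_velocity /A' /D' (max_idPr t0).
Qed.

(** The density vanishes in the vacuum, so that mass, momentum and momentum flux
    all live on the two moving regions; these are disjoint because [A] is
    nonnegative. *)
Lemma vacuum_regions x t : 0 <= t ->
  [/\ rho x t
      = \1_leftward (x - uL * A t) * rhoL + \1_rightward (x - uR * A t) * rhoR,
   rho x t * u x t
      = \1_leftward (x - uL * A t) * (rhoL * uL * D t)
        + \1_rightward (x - uR * A t) * (rhoR * uR * D t) &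
   rho x t * u x t ^+ 2
      = \1_leftward (x - uL * A t) * (rhoL * (uL * D t) ^+ 2)
        + \1_rightward (x - uR * A t) * (rhoR * (uR * D t) ^+ 2)].
Proof.
move=> t0; have At := amplitude_ge0 t.
have LR : uL * A t <= uR * A t by rewrite ler_wpM2r// ltW.
rewrite /vacuum_density /vacuum_velocity.
have eL : \1_leftward (x - uL * A t) = ((x < uL * A t)%R : bool)%:R :> R.
  by rewrite indicE mem_setE in_itv/= subr_lt0.
have eR : \1_rightward (x - uR * A t) = (~~ (x <= uR * A t)%R)%:R :> R.
  by rewrite indicE mem_setE in_itv/= andbT subr_gt0 ltNge.
rewrite eL eR; case: ifP => xL.
  by rewrite (le_trans (ltW xL) LR)/=; split; ring.
by case: ifP => xR /=; split; ring.
Qed.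

Lemma measurable_riemann_data (l r : R) :
  measurable_fun setT (riemann_data l r : line -> line).
Proof.
apply: measurable_fun_ifT => //; apply: measurable_fun_ltr => //.
Qed.

Lemma riemann_dataE (l r x : R) : x != 0 ->
  riemann_data l r x = l * \1_leftward x + r * \1_rightward x.
Proof.
move=> x0; rewrite /riemann_data !indicE !mem_setE !in_itv/= andbT.
by case: (ltgtP x 0) x0 => //= _ _; rewrite ?mulr1 ?mulr0 ?addr0 ?add0r.
Qed.

Lemma vacuum_mass_balance :
  weak_balance_law rho
    (fun x t => alpha t * (rho x t * u x t)) (fun _ _ => 0) (riemann_data rhoL rhoR).
Proof.
have aA := amplitude_antiderivative.
apply: (@weak_balance_law_two_regions R leftward rightward
  _ _ _ (fun=> rhoL) _ _ _ (fun=> rhoR) _ _ _ _ (measurable_itv _) (measurable_itv _)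
  (antiderivativeZ uL aA) _ (antiderivative_cst rhoL)
  (antiderivativeZ uR aA) _ (antiderivative_cst rhoR)).
- by rewrite amplitude0 mulr0.
- by rewrite amplitude0 mulr0.
- by move=> x t t0; have [] := vacuum_regions x t0.
- by move=> x t t0; have [_ -> _] := vacuum_regions x t0; ring.
- by move=> x t _; rewrite !mulr0 addr0.
- exact: measurable_riemann_data.
- by move=> x x0; exact: riemann_dataE.
Qed.

Lemma vacuum_momentum_balance :
  weak_balance_law (fun x t => rho x t * u x t)
    (fun x t => alpha t * (rho x t * u x t ^+ 2))
    (fun x t => - (sigma t * (rho x t * u x t)))
    (fun x => riemann_data rhoL rhoR x * riemann_data uL uR x).
Proof.
have aA := amplitude_antiderivative; have dD := damping_antiderivative.
apply: (@weak_balance_law_two_regions R leftward rightward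
  _ _ _ (fun t => rhoL * uL * D t) _ _ _ (fun t => rhoR * uR * D t) _ _ _ _
  (measurable_itv _) (measurable_itv _)
  (antiderivativeZ uL aA) _ (antiderivativeZ (rhoL * uL) dD)
  (antiderivativeZ uR aA) _ (antiderivativeZ (rhoR * uR) dD)).
- by rewrite amplitude0 mulr0.
- by rewrite amplitude0 mulr0.
- by move=> x t t0; have [] := vacuum_regions x t0.
- by move=> x t t0; have [_ _ ->] := vacuum_regions x t0; ring.
- by move=> x t t0; have [_ -> _] := vacuum_regions x t0; ring.
- by apply: measurable_funM; exact: measurable_riemann_data.
- move=> x x0; rewrite damping0 !mulr1 /riemann_data.
  have := riemann_dataE (rhoL * uL) (rhoR * uR) x0; rewrite /riemann_data => <-.
  by case: ifP.
Qed.

Lemma vacuum_initial_left x : x < 0 ->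
  rho x 0 = rhoL /\
  u x 0 = uL.
Proof.
by move=> x0; rewrite /vacuum_density /vacuum_velocity amplitude0 damping0 mulr0 x0 mulr1.
Qed.

Lemma vacuum_initial_right x : 0 < x ->
  rho x 0 = rhoR /\
  u x 0 = uR.
Proof.
move=> x0; rewrite /vacuum_density /vacuum_velocity amplitude0 damping0 !mulr0.
by rewrite (lt_gtF x0) (lt_geF x0) mulr1.
Qed.

End VacuumSolutionFacts.

Theorem mainTheorem5 (R : realType) (alpha sigma : R -> R)
    (rhoL uL rhoR uR : R)
    (alpha_L1 : L1_half_line alpha) (alpha_ge0 : nonneg_ae alpha)
    (sigma_L1loc : L1loc_half_line sigma) (sigma_ge0 : nonneg_ae sigma)
    (rhoL_gt0 : 0 < rhoL) (rhoR_gt0 : 0 < rhoR) (uL_lt_uR : uL < uR) :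
  riemann_solution alpha sigma rhoL uL rhoR uR
    (vacuum_density alpha sigma rhoL uL rhoR uR)
    (vacuum_velocity alpha sigma uL uR).
Proof.
have alpha_loc : L1loc_half_line alpha.
  move=> T; apply: integrableS alpha_L1 => //; apply: subset_itvl.
  by rewrite bnd_simp.
split.
- exact: measurable_vacuum_velocity.
- exact: vacuum_mass_balance.
- exact: vacuum_momentum_balance.
- exact: vacuum_initial_left.
- exact: vacuum_initial_right.
Qed.
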